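(* Let $G\in\mathcal{B}$ and let $r$ be an integer with $r\ge\max\{9,\Delta(G)\}$. Then $G$ is strongly equitably (SE) $r$-choosable.
   Context: Graphs are finite and simple; $|G|$ is the number of vertices and $\Delta(G)$ the maximum degree of $G$. For disjoint $X,Y\subseteq V(G)$, $\|X,Y\|$ is the number of edges of $G$ connecting $X$ with $Y$. $\mathcal{B}$ is the class of graphs $G$ such that $\|X,Y\|\le 2|X\cup Y|-4$ for all disjoint $X,Y\subseteq V(G)$ with $|X\cup Y|\ge 3$. An $r$-list assignment $L$ for $G$ assigns to each vertex $v$ a set $L(v)$ of exactly $r$ colors. An $L$-coloring of $G$ is a proper coloring $f$ of $G$ with $f(v)\in L(v)$ for every vertex $v$. For an integer $n$, $n\ \mathrm{mod}^*\ r$ denotes the unique integer $i\in\{1,\dots,r\}$ such that $n-i$ is divisible by $r$. For an $r$-list assignment $L$ of an $n$-vertex graph, an $L$-coloring is strongly equitable (SE) if all color classes have size at most $\lceil n/r\rceil$ and at most $n\ \mathrm{mod}^*\ r$ color classes have size exactly $\lceil n/r\rceil$. A graph $G$ is strongly equitably (SE) $r$-choosable if it has an SE $L$-coloring for every $r$-list assignment $L$. *)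

(* Defs.v *)
From mathcomp Require Import all_boot.

Set Implicit Arguments.
Unset Strict Implicit.
Unset Printing Implicit Defensive.

Definition ceil_div (n r : nat) : nat := n %/ r + ~~ (r %| n).

(* The representative of n modulo r in {1, ..., r}, for r > 0. *)
Definition modstar (n r : nat) : nat := if r %| n then r else n %% r.

Lemma modstarP (n r i : nat) : 0 < r -> 0 < i <= r ->
  (i == modstar n r) = (n == i %[mod r]).
Proof.
move=> r_gt0 /andP[i_gt0]; rewrite /modstar /dvdn leq_eqVlt.
case/orP=> [/eqP->|lt_ir]; last rewrite (modn_small lt_ir).
  rewrite modnn; case: ifP => [_|_]; first by rewrite eqxx.
  by rewrite gtn_eqF // ltn_mod.
by case: ifP => [/eqP->|_]; [rewrite !ltn_eqF | rewrite eq_sym].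
Qed.

Lemma ceil_divP (n r m : nat) : 0 < r -> (ceil_div n r <= m) = (n <= m * r).
Proof.
move=> r_gt0; rewrite /ceil_div; case: (boolP (r %| n)) => [rn|nrn] /=.
  by rewrite addn0 leq_divLR.
rewrite addn1 ltn_divLR // [RHS]leq_eqVlt.
by case: eqP nrn => // ->; rewrite dvdn_mull.
Qed.

Record sgraph := SGraph {
  vertex :> finType;
  adj : rel vertex;
  adj_sym : symmetric adj;
  adj_irrefl : irreflexive adj
}.

Section GraphNotions.
Variable G : sgraph.

Definition max_degree : nat := \max_(v : G) #|[set w | adj v w]|.

(* Each edge between X and Y is counted by its pair (endpoint in X, endpoint
   in Y); when X and Y are disjoint this counts every such edge once. *)
Definition edges_between (X Y : {set G}) : nat :=
  #|[set p : G * G | [&& p.1 \in X, p.2 \in Y & adj p.1 p.2]]|.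

(* As 3 <= #|X :|: Y|, the subtraction is never truncated. *)
Definition in_classB : Prop :=
  forall X Y : {set G}, [disjoint X & Y] -> 3 <= #|X :|: Y| ->
    edges_between X Y <= 2 * #|X :|: Y| - 4.

Section Colorings.
Variable C : finType.

Definition list_assignment (r : nat) (L : G -> {set C}) : Prop :=
  forall v, #|L v| = r.

Definition list_coloring (L : G -> {set C}) (f : {ffun G -> C}) : Prop :=
  (forall v, f v \in L v) /\ (forall u v, adj u v -> f u != f v).

(* Only nonempty classes are counted; this matters for the graph without
   vertices only, where ceil_div is 0. *)
Definition color_classes (f : {ffun G -> C}) : {set {set G}} :=
  preim_partition f [set: G].

Definition strongly_equitable (r : nat) (f : {ffun G -> C}) : Prop :=
  (forall A, A \in color_classes f -> #|A| <= ceil_div #|G| r) /\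
  #|[set A in color_classes f | #|A| == ceil_div #|G| r]| <= modstar #|G| r.

End Colorings.

(* Finite color types lose no generality: finitely many finite lists involve
   finitely many colors. *)
Definition SE_choosable (r : nat) : Prop :=
  forall (C : finType) (L : G -> {set C}), list_assignment r L ->
    exists f : {ffun G -> C}, list_coloring L f /\ strongly_equitable r f.

End GraphNotions.

(* Main.v *)
Require Import Defs.
From mathcomp Require Import all_boot.
From mathcomp Require Import zify.

Set Implicit Arguments.
Unset Strict Implicit.
Unset Printing Implicit Defensive.

(* Idea. Vertices are coloured one at a time; the new vertex v is chosen with
   at most 6 coloured neighbours, which a maximum cut provides. With s the
   target class size, call a colour bad if no chain of single-vertex moves
   leads from it to a class smaller than s; bad classes are full. If a set K of
   full colours is closed under moves, every vertex coloured from K has at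
   least r - |K| neighbours outside, and the edge bound of class B leaves only
   |K| <= 2 or |K| >= r - 2. If v cannot be inserted, the colours reachable
   from v form such a set of size at least 3, so r - 2 or r - 1 colours are bad.
   Take a colouring with the fewest bad colours. Counting edges between good
   and bad classes, some good vertex y has many solo neighbours, i.e. bad
   vertices x whose only neighbour in the class of y is y. Exchanging y with
   one solo neighbour makes a non-adjacent second one movable to a good class,
   so minimality forbids y to reach the classes of its solo neighbours. The
   classes y does reach form a small closed set, and counting the neighbours of
   y, together with one further cut of the graph, gives the contradiction. *)

(** * Edges and cuts *)

Section Edges.
Variable G : sgraph.
Implicit Types (X Y : {set G}) (x y : G).

Definition nbrs x : {set G} := [set w | adj x w].

Lemma in_nbrs x y : (y \in nbrs x) = adj x y.
Proof. by rewrite inE. Qed.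

Lemma nbrsC x y : (y \in nbrs x) = (x \in nbrs y).
Proof. by rewrite !in_nbrs adj_sym. Qed.

Lemma card_set_sum (T : finType) (A : {set T}) (P : pred T) :
  #|[set t in A | P t]| = \sum_(t in A) P t.
Proof.
rewrite -sum1_card (eq_bigl (fun t => (t \in A) && P t)); last first.
  by move=> t; rewrite inE.
by rewrite big_mkcondr; apply: eq_bigr => t _; case: (P t).
Qed.

Lemma card_nbrsI x Y : #|nbrs x :&: Y| = \sum_(y in Y) adj x y.
Proof.
by rewrite -card_set_sum; apply: eq_card => y; rewrite !inE andbC.
Qed.

Lemma sum_nbrsC X Y :
  \sum_(x in X) #|nbrs x :&: Y| = \sum_(y in Y) #|nbrs y :&: X|.
Proof.
under eq_bigr do rewrite card_nbrsI.
rewrite exchange_big; apply: eq_bigr => y _; rewrite card_nbrsI.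
by apply: eq_bigr => x _; rewrite adj_sym.
Qed.

Lemma edges_betweenE X Y : edges_between X Y = \sum_(x in X) #|nbrs x :&: Y|.
Proof.
under eq_bigr => x _ do rewrite card_nbrsI.
rewrite pair_big_dep /edges_between -sum1_card.
rewrite (eq_bigl (fun p : G * G => ((p.1 \in X) && (p.2 \in Y)) && adj p.1 p.2)).
  by rewrite big_mkcondr; apply: eq_bigr => p _; case: adj.
by move=> p; rewrite inE andbA.
Qed.

Lemma card_nbrsIU x X Y : [disjoint X & Y] ->
  #|nbrs x :&: (X :|: Y)| = #|nbrs x :&: X| + #|nbrs x :&: Y|.
Proof.
move=> dXY; rewrite setIUr cardsU setIACA setIid.
by rewrite (disjoint_setI0 dXY) setI0 cards0 subn0.
Qed.

Hypothesis classB : in_classB G.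

Lemma classB_sum X Y : [disjoint X & Y] -> 3 <= #|X :|: Y| ->
  \sum_(x in X) #|nbrs x :&: Y| + 4 <= 2 * #|X :|: Y|.
Proof. by move=> dXY le3; have := classB dXY le3; rewrite edges_betweenE; lia. Qed.

(* In a maximum cut every vertex has at least half of its neighbours on the
   other side; for degree at least 7 this means at least 4, so that the cut
   has at least 2|U| edges. *)
Lemma exists_low_degree (U : {set G}) : U != set0 ->
  exists2 v, v \in U & #|nbrs v :&: U| <= 6.
Proof.
move=> nU; pose cut X := \sum_(x in X) #|nbrs x :&: (U :\: X)|.
case: (pickP [pred v | (v \in U) && (#|nbrs v :&: U| <= 6)]) => [v /andP[]|hi].
  by exists v.
have {}hi v : v \in U -> 7 <= #|nbrs v :&: U|.
  by move=> vU; have := hi v; rewrite /= vU /=; lia.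
case: (@arg_maxnP _ set0 (fun X : {set G} => X \subset U) cut (sub0set _)).
move=> X sXU maxX.
have dX : [disjoint X & U :\: X] by rewrite disjoints_subset setCD subsetUr.
have UE : X :|: (U :\: X) = U by rewrite -{1}(setIidPr sXU) setID.
have degE v : #|nbrs v :&: U| = #|nbrs v :&: X| + #|nbrs v :&: (U :\: X)|.
  by rewrite -card_nbrsIU // UE.
have cutE v (Y : {set G}) : v \notin Y -> v \in U -> Y \subset U ->
    cut (v |: Y) + #|nbrs v :&: Y| = cut Y + #|nbrs v :&: (U :\: Y)|.
  move=> vY vU sYU; rewrite /cut big_setU1 //=.
  have -> : nbrs v :&: (U :\: (v |: Y)) = nbrs v :&: (U :\: Y).
    apply/setP=> z; rewrite !inE negb_or; case: eqP => //= ->.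
    by rewrite adj_irrefl.
  suff: \sum_(x in Y) #|nbrs x :&: (U :\: Y)| =
    \sum_(x in Y) #|nbrs x :&: (U :\: (v |: Y))| + #|nbrs v :&: Y| by lia.
  rewrite card_nbrsI -big_split; apply: eq_bigr => x xY.
  rewrite [in LHS](cardsD1 v) !inE vY vU andbT adj_sym addnC; congr (_ + _).
    by apply: eq_card => z; rewrite !inE; case: (z == v); rewrite /= ?andbF.
  by rewrite andbT.
have highX : {in X, forall v, 4 <= #|nbrs v :&: (U :\: X)|}.
  move=> v vX; have vU := subsetP sXU v vX.
  have sY : X :\ v \subset U by apply: subset_trans sXU; rewrite subsetDl.
  have := cutE v (X :\ v) _ vU sY; rewrite !inE eqxx setD1K // => /(_ isT).
  have := maxX _ sY; have := hi v vU; have := degE v.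
  have -> : nbrs v :&: (X :\ v) = nbrs v :&: X.
    by apply/setP=> z; rewrite !inE; case: eqP => //= ->; rewrite adj_irrefl.
  have -> : nbrs v :&: (U :\: (X :\ v)) = nbrs v :&: (U :\: X).
    apply/setP=> z; rewrite !inE; case: eqP => //= ->.
    by rewrite adj_irrefl.
  lia.
have highY : {in U :\: X, forall v, 4 <= #|nbrs v :&: X|}.
  move=> v; rewrite inE => /andP[vX vU].
  have sY : v |: X \subset U by rewrite subUset sub1set vU.
  have := cutE v X vX vU sXU; have := maxX _ sY; have := hi v vU.
  by have := degE v; lia.
have [v vU] := set0Pn _ nU.
have leU : 7 <= #|U| by apply: leq_trans (hi v vU) (subset_leq_card (subsetIr _ _)).
have := classB_sum dX; rewrite UE => /(_ (leq_trans _ leU) ).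
have : 4 * #|X| <= \sum_(x in X) #|nbrs x :&: (U :\: X)|.
  by rewrite mulnC -sum_nat_const; apply: leq_sum => x /highX.
have : 4 * #|U :\: X| <= \sum_(x in X) #|nbrs x :&: (U :\: X)|.
  by rewrite sum_nbrsC mulnC -sum_nat_const; apply: leq_sum => x /highY.
have : #|U| = #|X| + #|U :\: X| by rewrite -{1}UE cardsU (disjoint_setI0 dX) cards0 subn0.
by move=> -> le1 le2 /(_ isT); lia.
Qed.

Definition undominating (S : {set G}) : {set G} :=
  [set x in S | [exists z in S, (z != x) && ~~ adj x z]].

(** Two vertices adjacent to all others of [S] would form, with [y], one side of a complete
    bipartite graph with sides 3 and [#|S| - 2]. Its edges exceed the class B bound once [#|S|] is
    at least 5. *)
Lemma card_undominating (S : {set G}) y : S \subset nbrs y -> 5 <= #|S| ->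
  #|S| <= #|undominating S| + 1.
Proof.
move=> sSy S5; rewrite -(cardsID (undominating S) S).
have -> : S :&: undominating S = undominating S.
  by apply/setIidPr/subsetP=> x; rewrite inE => /andP[].
rewrite leq_add2l leqNgt; apply/negP => /card_gt1P[x1 [x2 []]].
have domP x z : x \in S :\: undominating S -> z \in S -> z != x -> adj x z.
  rewrite !inE => /andP[nu xS] zS zx; rewrite xS /= in nu.
  by apply: contraNT nu => nxz; apply/exists_inP; exists z => //; rewrite zx.
move=> x1D x2D x12; have x1S : x1 \in S by case/setDP: x1D.
have x2S : x2 \in S by case/setDP: x2D.
pose X := [set y; x1; x2]; pose Y := S :\: [set x1; x2].
have yS : y \notin S by apply/negP => /(subsetP sSy); rewrite in_nbrs adj_irrefl.
have yx1 : y != x1 by apply: contraNneq yS => ->.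
have yx2 : y != x2 by apply: contraNneq yS => ->.
have cX : #|X| = 3.
  by rewrite /X -setUA cardsU1 cards2 !inE negb_or yx1 yx2 x12.
have cY : #|Y| = #|S| - 2.
  rewrite cardsDS ?cards2 ?x12 //.
  by apply/subsetP=> w; rewrite !inE => /orP[] /eqP->.
have dXY : [disjoint X & Y].
  apply/pred0P=> w; rewrite /= !inE negb_or; case: eqP => [->|_] /=.
    by rewrite (negPf yS) andbF.
  by case: eqP => //=; case: eqP.
have := classB_sum dXY; rewrite cardsU (disjoint_setI0 dXY) cards0 subn0 cX cY.
have -> : \sum_(x in X) #|nbrs x :&: Y| = 3 * (#|S| - 2).
  rewrite -cY -cX -sum_nat_const; apply: eq_bigr => x xX; congr #|pred_of_set _|.
  apply/setIidPr/subsetP=> w; rewrite !inE negb_or => /andP[/andP[w1 w2] wS].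
  move: xX; rewrite !inE -orbA => /or3P[] /eqP->; last 2 first; [exact: domP | exact: domP | ].
  by have := subsetP sSy w wS; rewrite in_nbrs.
by move/(_ isT); lia.
Qed.

End Edges.

(** * Partial list colorings and moves *)

Section PartialColorings.
Variables (G : sgraph) (C : finType) (L : G -> {set C}).
Implicit Types (f g : {ffun G -> option C}) (x y z : G) (c d : C) (K J : {set C}).

Definition cls f c : {set G} := [set x | f x == Some c].
Definition clss f K : {set G} := [set x | if f x is Some c then c \in K else false].
Definition dom f : {set G} := [set x | isSome (f x)].

(** [x] may already be coloured: as it is not its own neighbour, its present colour does not block
    it. The same predicate thus serves for properness and for moves. *)
Definition free f x c := (c \in L x) && [disjoint nbrs x & cls f c].

Definition proper_col f := [forall x, if f x is Some c then free f x c else true].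

Definition mv f : rel C := fun c d => [exists x in cls f c, free f x d].

Definition closed_colors f K := forall c d, c \in K -> mv f c d -> d \in K.

Definition upd f x o : {ffun G -> option C} :=
  [ffun z => if z == x then o else f z].

Lemma proper_colP f : reflect (forall x c, f x = Some c -> free f x c) (proper_col f).
Proof.
apply: (iffP forallP) => [fP x c fx|fP x]; first by have := fP x; rewrite fx.
by case fx: (f x) => [c|//]; apply: fP.
Qed.

Lemma freeP f x c : reflect (c \in L x /\ (forall z, adj x z -> f z <> Some c)) (free f x c).
Proof.
apply: (iffP andP) => -[cL dis]; split=> //.
  by move=> z xz /eqP fz; have /pred0P/(_ z) := dis; rewrite /= !inE xz fz.
apply/pred0P=> z /=; rewrite !inE; case xz: (adj x z) => //=.
by apply/eqP/dis.
Qed.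

Lemma nfreeP f x c : c \in L x -> ~~ free f x c -> 0 < #|nbrs x :&: cls f c|.
Proof. by rewrite /free => -> /=; rewrite -setI_eq0 card_gt0. Qed.

Lemma mvP f c d : reflect (exists2 x, f x = Some c & free f x d) (mv f c d).
Proof.
apply: (iffP exists_inP) => -[x fx xd]; exists x => //; last by rewrite inE fx.
by move: fx; rewrite inE => /eqP.
Qed.

Lemma in_cls f c x : (x \in cls f c) = (f x == Some c).
Proof. by rewrite inE. Qed.

Lemma in_clss f K x c : f x = Some c -> (x \in clss f K) = (c \in K).
Proof. by move=> fx; rewrite inE fx. Qed.

Lemma clssP f K x : reflect (exists2 c, f x = Some c & c \in K) (x \in clss f K).
Proof.
rewrite inE; case: (f x) => [d|]; last by constructor=> -[].
by apply: (iffP idP) => [dK|[c [->]]//]; exists d.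
Qed.

Lemma cls1 f c : clss f [set c] = cls f c.
Proof. by apply/setP=> x; rewrite !inE; case: (f x) => // d; rewrite inE. Qed.

Lemma clss_sub_dom f K : clss f K \subset dom f.
Proof. by apply/subsetP=> x; rewrite !inE; case: (f x). Qed.

Lemma disjoint_clss f K J : [disjoint K & J] -> [disjoint clss f K & clss f J].
Proof.
move=> /pred0P dKJ; apply/pred0P=> x /=; rewrite !inE.
by case: (f x) => // c; apply: dKJ.
Qed.

Lemma clssU f K J : clss f (K :|: J) = clss f K :|: clss f J.
Proof. by apply/setP=> x; rewrite !inE; case: (f x) => // c; rewrite inE. Qed.

Lemma clssC f K : clss f K :|: clss f (~: K) = dom f.
Proof.
by apply/setP=> x; rewrite !inE; case: (f x) => // c; rewrite inE orbN.
Qed.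

Lemma card_clssI f K (A : {set G}) :
  #|A :&: clss f K| = \sum_(c in K) #|A :&: cls f c|.
Proof.
have -> : A :&: clss f K = [set x in A | x \in clss f K] by apply/setP=> x; rewrite !inE.
rewrite card_set_sum.
transitivity (\sum_(c in K) \sum_(x in A) (f x == Some c)).
  rewrite exchange_big; apply: eq_bigr => x _; rewrite inE.
  case: (f x) => [d|]; last by rewrite big1.
  rewrite -card_set_sum; case: (boolP (d \in K)) => dK.
    rewrite (_ : [set _ in _ | _] = [set d]) ?cards1 //; apply/setP=> c.
    by rewrite !inE eq_sym (inj_eq Some_inj); case: eqP => [->|]; rewrite ?dK ?andbF.
  apply/esym/eqP; rewrite cards_eq0 -subset0; apply/subsetP=> c; rewrite !inE.
  by rewrite (inj_eq Some_inj) => /andP[cK /eqP dc]; rewrite dc cK in dK.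
by apply: eq_bigr => c _; rewrite -card_set_sum; apply: eq_card => x; rewrite !inE.
Qed.

Lemma card_clss f K : #|clss f K| = \sum_(c in K) #|cls f c|.
Proof.
by rewrite -[clss f K]setTI card_clssI; apply: eq_bigr => c _; rewrite setTI.
Qed.

Lemma card_clss_full f K s : (forall c, c \in K -> #|cls f c| = s) ->
  #|clss f K| = #|K| * s.
Proof. by move=> Ks; rewrite card_clss -sum_nat_const; apply: eq_bigr. Qed.

(** Each colour of [L x :&: K] is blocked by a neighbour of [x] in that class, and different classes
    are disjoint. *)
Lemma card_nbrs_clss f x K J : {subset K <= J} ->
  (forall c, c \in L x -> c \in K -> ~~ free f x c) ->
  #|L x :&: K| <= #|nbrs x :&: clss f J|.
Proof.
move=> sKJ nf; rewrite card_clssI (bigID (mem (L x :&: K))) /=.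
rewrite -sum1_card (eq_bigl (fun c => (c \in J) && (c \in L x :&: K))).
  apply: leq_trans (leq_addr _ _); apply: leq_sum => c.
  by rewrite !inE => /and3P[cJ cL cK]; rewrite nfreeP // nf.
by move=> c; rewrite inE; case: (boolP (c \in K)) => [/sKJ ->|]; rewrite ?andbF.
Qed.

Lemma closed_nfree f K x c d : closed_colors f K -> f x = Some c -> c \in K ->
  d \notin K -> ~~ free f x d.
Proof.
move=> clK fx cK; apply: contra => xd; apply: (clK c) => //.
by apply/mvP; exists x.
Qed.

(** A vertex coloured from a closed set is free for no colour outside it, so each such colour in its
    list costs a neighbour. This bounds from below the edges leaving a closed set. *)
Lemma closed_nbrs f K J x : closed_colors f K -> x \in clss f K -> [disjoint K & J] ->
  #|L x :&: J| <= #|nbrs x :&: clss f J|.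
Proof.
move=> clK /clssP[c fx cK] /pred0P dKJ; apply: card_nbrs_clss => // d _ dJ.
apply: closed_nfree clK fx cK _; apply/negP=> dK.
by have := dKJ d; rewrite /= dK dJ.
Qed.

Lemma closedI f K J : closed_colors f K -> closed_colors f J -> closed_colors f (K :&: J).
Proof.
move=> clK clJ c d; rewrite !inE => /andP[cK cJ] cd.
by rewrite (clK c) // (clJ c).
Qed.

Lemma updE f x o z : upd f x o z = if z == x then o else f z.
Proof. by rewrite ffunE. Qed.

Lemma cls_upd f x o c :
  cls (upd f x o) c = if o == Some c then x |: cls f c else cls f c :\ x.
Proof.
apply/setP=> z; case: ifP => oc; by rewrite !inE updE; case: (z == x) => //=.
Qed.

Lemma dom_upd f x o : dom (upd f x o) = if o then x |: dom f else dom f :\ x.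
Proof. by apply/setP=> z; case: o => [c|]; rewrite !inE updE; case: (z == x). Qed.

Lemma free_upd_self f x o c : free (upd f x o) x c = free f x c.
Proof.
apply/freeP/freeP => -[cL nf]; split=> // z xz; have := nf z xz; rewrite updE;
  by case: eqP xz => // ->; rewrite adj_irrefl.
Qed.

Lemma free_sub f g x c : cls g c \subset cls f c -> free f x c -> free g x c.
Proof.
rewrite /free => s /andP[-> /=]; rewrite !(disjoint_sym (mem (nbrs x))).
exact: disjointWl.
Qed.

Lemma proper_col_upd f x c : proper_col f -> free f x c -> proper_col (upd f x (Some c)).
Proof.
move=> /proper_colP fP /[dup] xc /freeP[cL nx]; apply/proper_colP=> z d; rewrite updE.
case: eqP => [-> [<-]|/eqP zx fz]; first by rewrite free_upd_self.
have /freeP[dL nz] := fP z d fz; apply/freeP; split=> // w zw; rewrite updE.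
case: eqP => [wx [cd]|_]; last exact: nz.
by apply: (nx z); rewrite ?cd // adj_sym -wx.
Qed.

Lemma proper_col_clear f x : proper_col f -> proper_col (upd f x None).
Proof.
move=> /proper_colP fP; apply/proper_colP=> z d; rewrite updE; case: eqP => // _ fz.
by apply: free_sub (fP z d fz); rewrite cls_upd subsetDl.
Qed.

Lemma card_cls_upd f x o c :
  #|cls (upd f x o) c| + (f x == Some c) = #|cls f c| + (o == Some c).
Proof.
rewrite cls_upd; case: ifP => oc; rewrite ?cardsU1 ?in_cls.
  by rewrite addnAC addnC; case: eqP.
by rewrite [in RHS](cardsD1 x) in_cls addnC addn0.
Qed.

(* Chain of moves: [u] enters class [c], which sends one of its vertices to
   the next class of the path, and so on. *)
Lemma insert_path f u c p : proper_col f -> f u = None -> free f u c ->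
    path (mv f) c p -> uniq (c :: p) ->
  exists g, [/\ proper_col g, dom g = u |: dom f,
    forall d, #|cls g d| = #|cls f d| + (d == last c p)
    & forall d, d \notin c :: p -> cls g d = cls f d].
Proof.
elim: p f u c => [|d p IHp] f u c fP fu uc /=.
  move=> _ _; exists (upd f u (Some c)); split.
  - exact: proper_col_upd.
  - by rewrite dom_upd.
  - move=> e; have := card_cls_upd f u (Some c) e; rewrite fu /= addn0 => ->.
    by rewrite (inj_eq Some_inj) eq_sym.
  - move=> e; rewrite inE cls_upd (inj_eq Some_inj) eq_sym => /negPf ->.
    by apply/setP=> z; rewrite !inE; case: eqP => // ->; rewrite fu.
case/andP=> /mvP[w fw wd] dp /andP[c_dp dp_uniq].
have wu : w != u by apply: contraPneq fw => ->; rewrite fu.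
(* [u] takes the place of [w] in class [c]; [w] is now the uncoloured vertex to be inserted along
   the shorter path. *)
pose f1 := upd (upd f w None) u (Some c).
have cls1 e : e != c -> cls f1 e = cls f e.
  move=> ec; rewrite /f1 !cls_upd (inj_eq Some_inj) eq_sym (negPf ec) /=.
  apply/setP=> z; rewrite !inE; case: eqP => [->|_] /=; first by rewrite fu.
  by case: eqP => //= ->; rewrite fw (inj_eq Some_inj) eq_sym (negPf ec).
have c_in e : e \in d :: p -> e != c by apply: contraTneq => ->.
have f1P : proper_col f1.
  apply: proper_col_upd; first exact: proper_col_clear.
  by apply: free_sub uc; rewrite cls_upd subsetDl.
have f1w : f1 w = None by rewrite !updE (negPf wu) eqxx.
have wd1 : free f1 w d by apply: free_sub wd; rewrite cls1 ?c_in ?mem_head.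
have dp1 : path (mv f1) d p.
  apply: (sub_in_path (P := mem (d :: p))) dp.
    move=> e e' eP e'P /exists_inP[z ze zfr]; apply/exists_inP; exists z.
      by rewrite cls1 ?c_in.
    by apply: free_sub zfr; rewrite cls1 ?c_in.
  exact/allP.
have [g [gP gdom gcard gcls]] := IHp f1 w d f1P f1w wd1 dp1 dp_uniq.
exists g; split=> //.
- rewrite gdom !dom_upd /=; apply/setP=> z; rewrite !inE.
  by case: (z =P w) => [->|//]; rewrite fw orbT.
- move=> e; rewrite gcard; congr (_ + _).
  have := card_cls_upd (upd f w None) u (Some c) e.
  have := card_cls_upd f w None e.
  by rewrite updE (eq_sym u w) (negPf wu) fu fw -/f1 !addn0 => <- ->.
- move=> e; rewrite inE negb_or => /andP[ec edp].
  by rewrite gcls // cls1.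
Qed.

(** A move survives if its vertex keeps its colour and its target class gains nothing. The last
    class of the path sends out no vertex, hence the exemption [d != last c p]. *)
Lemma path_transfer f g c p : uniq (c :: p) -> path (mv f) c p ->
    (forall w d, d \in c :: p -> d != last c p -> f w = Some d -> g w = f w) ->
    (forall d, d \in c :: p -> cls g d \subset cls f d) ->
  path (mv g) c p.
Proof.
elim: p c => //= d p IHp c /andP[c_dp dp_uniq] /andP[/mvP[w fw wd] dp] Hsrc Htgt.
apply/andP; split.
  apply/mvP; exists w.
    rewrite (Hsrc w c) ?mem_head //.
    by apply: contraNneq c_dp => ->; apply: mem_last.
  by apply: free_sub wd; apply: Htgt; rewrite !inE eqxx orbT.
apply: IHp => // [w' e eP | e eP]; first by apply: Hsrc; rewrite inE eP orbT.
by apply: Htgt; rewrite inE eP orbT.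
Qed.

End PartialColorings.

(** * Counting *)

Section Solo.
Variables (G : sgraph) (C : finType) (L : G -> {set C}).
Implicit Types (f : {ffun G -> option C}) (x y : G) (J : {set C}).

(** Once [y] leaves its class, [x] may enter it; for this the colour of [y] has to lie in [L x]. *)
Definition solo f (X : {set G}) y : {set G} :=
  [set x in X | if f y is Some c then (c \in L x) && (nbrs x :&: cls f c == [set y]) else false].

(** By [solo_nbrs], edges to solo neighbours are counted twice. Under a degree bound, a large weight
    forces many solo neighbours. *)
Definition weight f (X : {set G}) y := #|nbrs y :&: X| + #|solo f X y|.

Lemma solo_nbrs f X y : solo f X y \subset nbrs y :&: X.
Proof.
apply/subsetP=> x; rewrite 2!inE; case: (f y) => [c|]; last by rewrite andbF.
case/and3P=> -> _ /eqP E; rewrite andbT nbrsC.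
by have := set11 y; rewrite -E inE => /andP[].
Qed.

(* Each colour of [J] in [L x] contributes at least 2 to the right-hand side:
   either two neighbours, or one neighbour for which [x] is solo. *)
Lemma sum_weight f (X : {set G}) J a :
    (forall x, x \in X -> a <= #|L x :&: J|) ->
    (forall x c, x \in X -> c \in J -> ~~ free L f x c) ->
  2 * (#|X| * a) <= \sum_(y in clss f J) weight f X y.
Proof.
move=> leJ nf; rewrite big_split /= -sum_nbrsC.
have -> : \sum_(y in clss f J) #|solo f X y| = \sum_(x in X) #|[set y in clss f J | x \in solo f X y]|.
  rewrite (eq_bigr (fun y => \sum_(x in X) (x \in solo f X y))) => [|y _].
    by rewrite exchange_big; apply: eq_bigr => x _; rewrite card_set_sum.
  by rewrite -card_set_sum; apply: eq_card => x; rewrite !inE andbA andbb.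
rewrite -big_split -sum_nat_const big_distrr; apply: leq_sum => x xX.
have -> : [set y in clss f J | x \in solo f X y] = [set y | x \in solo f X y] :&: clss f J.
  by apply/setP=> y; rewrite !inE andbC.
rewrite !card_clssI -big_split (bigID (mem (L x))) /=.
apply: leq_trans (leq_addr _ _).
apply: (@leq_trans (\sum_(c in J | c \in L x) 2)); last first.
  apply: leq_sum => c /andP[cJ cL].
  have := nfreeP cL (nf x c xX cJ).
  case n1 : (#|nbrs x :&: cls f c| == 1); last by lia.
  move=> _; have /cards1P[y yE] := n1; rewrite (eqP n1) ltnS card_gt0.
  apply/set0Pn; exists y.
  have : y \in nbrs x :&: cls f c by rewrite yE inE.
  by rewrite !inE => /andP[_ fy]; rewrite xX (eqP fy) cL yE !eqxx.
rewrite sum_nat_const mulnC leq_mul2r orbC.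
by rewrite (leq_trans (leJ x xX)) //; apply: subset_leq_card; apply/subsetP=> c; rewrite !inE andbC.
Qed.

End Solo.

(** * Edge counts around closed sets of full colours *)

Section Counting.
Variables (G : sgraph) (C : finType) (L : G -> {set C}) (r : nat).
Hypothesis classB : in_classB G.
Hypothesis listr : list_assignment r L.
Hypothesis r_ge9 : 9 <= r.
Implicit Types (f g : {ffun G -> option C}) (x y z : G) (c d : C) (K J B : {set C}).

Lemma card_list_split x K : #|L x :&: K| + #|L x :&: ~: K| = r.
Proof. by rewrite -setDE cardsID listr. Qed.

Lemma disjointC_set (T : finType) (K : {set T}) : [disjoint K & ~: K].
Proof. by rewrite disjoints_subset setCK. Qed.

(** With [k = #|K|], the cut around [clss f K] has at least [k * s * (r - k)] edges, so the class B
    bound gives [k * (r - k) < 2 * r]. For [3 <= k <= r - 3] the product is at least [3 * (r - 3)],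
    which is at least [2 * r] since [r >= 9]. *)
Lemma closed_count f K s : #|dom f| < r * s -> (forall c, c \in K -> #|cls f c| = s) ->
  closed_colors L f K -> (#|K| <= 2) || (r - 2 <= #|K|).
Proof.
move=> ltD fullK clK; apply/norP => -[]; rewrite -!ltnNge => k_gt2 k_lt.
have dXY := disjoint_clss f (disjointC_set K).
have cX := card_clss_full fullK.
have leX := subset_leq_card (clss_sub_dom f K).
have s_gt0 : 0 < s by case: (s) ltD => //; rewrite muln0.
have le3 : 3 <= #|dom f| by rewrite cX in leX; nia.
have := classB_sum classB dXY; rewrite clssC => /(_ le3) leE.
have : #|clss f K| * (r - #|K|) <= \sum_(x in clss f K) #|nbrs x :&: clss f (~: K)|.
  rewrite -sum_nat_const; apply: leq_sum => x xX.
  apply: leq_trans (closed_nbrs clK xX (disjointC_set K)).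
  by have := card_list_split x K; have := subset_leq_card (subsetIr (L x) K); lia.
rewrite cX => le2.
have : 3 * (r - 3) <= #|K| * (r - #|K|) by nia.
nia.
Qed.

(* Vertices of the two classes in [K] go to whichever side of the cut
   (classes outside [B]) / (classes in [B :\: K]) gives them the more edges. *)
Lemma closed_pair_cut f B K s m : #|dom f| < r * s -> #|B| < r -> 4 < #|B| ->
    (forall c, c \in B -> #|cls f c| = s) -> K \subset B -> #|K| = 2 ->
    closed_colors L f B -> closed_colors L f K ->
    (forall x, x \in clss f K -> (m <= #|L x :&: (B :\: K)|) || (m <= #|L x :&: ~: B|)) ->
  s * (2 * m + (#|B| - 2) * (r - #|B|)) < 2 * (r * s).
Proof.
move=> ltD B_ltr B_gt4 fullB sKB cK clB clK Hm.
pose X1 := [set x in clss f K | m <= #|L x :&: (B :\: K)|].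
pose X2 := clss f K :\: X1.
have sX1 : X1 \subset clss f K by apply/subsetP=> x; rewrite inE => /andP[].
have s_gt0 : 0 < s by case: (s) ltD => //; rewrite muln0.
have disQ J : J \subset B -> [disjoint clss f (~: B) & clss f J].
  move=> sJ; apply: disjoint_clss; rewrite disjoint_sym.
  by apply: disjointWl sJ (disjointC_set B).
have disK : [disjoint clss f K & clss f (B :\: K)].
  by apply: disjoint_clss; rewrite disjoints_subset setCD subsetUr.
have disQX1 : [disjoint clss f (~: B) & X1] by apply: disjointWr sX1 (disQ _ sKB).
have disBX2 : [disjoint clss f (B :\: K) & X2].
  by rewrite disjoint_sym; apply: disjointWl disK; apply: subsetDl.
have disXY : [disjoint clss f (~: B) :|: X1 & clss f (B :\: K) :|: X2].
  rewrite -setI_eq0 setIUl !setIUr !setU_eq0 !setI_eq0 (disQ _ (subsetDl _ _)) /=.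
  rewrite (disjointWr (subsetDl _ _) (disQ _ sKB)) (disjointWl sX1 disK) /=.
  by rewrite disjoints_subset setCD subsetUr.
have UE : (clss f (~: B) :|: X1) :|: (clss f (B :\: K) :|: X2) = dom f.
  rewrite setUACA -setUA.
  have -> : X1 :|: X2 = clss f K by rewrite /X2 -{1}(setIidPr sX1) setID.
  rewrite -clssU -(clssC f B) setUC; congr (clss f _ :|: _).
  by rewrite setUC -{1}(setIidPr sKB) setID.
have le3 : 3 <= #|dom f|.
  apply: leq_trans (subset_leq_card (clss_sub_dom f B)).
  by rewrite (card_clss_full fullB); nia.
have := classB_sum classB disXY; rewrite UE => /(_ le3).
rewrite sum_nbrsC (eq_bigl [predU clss f (B :\: K) & X2]) => [|y]; last by rewrite in_setU.
rewrite bigU //=.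
have eY : #|clss f (B :\: K)| * (r - #|B|) + \sum_(x in X1) #|nbrs x :&: clss f (B :\: K)|
    <= \sum_(y in clss f (B :\: K)) #|nbrs y :&: (clss f (~: B) :|: X1)|.
  rewrite sum_nbrsC -sum_nat_const -big_split; apply: leq_sum => y yY.
  rewrite card_nbrsIU // leq_add2r.
  have yB : y \in clss f B by case/clssP: yY => c fy; rewrite inE (in_clss _ fy) => /andP[].
  apply: leq_trans (closed_nbrs clB yB (disjointC_set B)).
  by have := card_list_split y B; have := subset_leq_card (subsetIr (L y) B); lia.
have eX1 : #|X1| * m <= \sum_(x in X1) #|nbrs x :&: clss f (B :\: K)|.
  rewrite -sum_nat_const; apply: leq_sum => x; rewrite inE => /andP[xK le_m].
  apply: leq_trans le_m _; apply: closed_nbrs clK xK _.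
  by rewrite disjoints_subset setCD subsetUr.
have eX2 : #|X2| * m <= \sum_(x in X2) #|nbrs x :&: (clss f (~: B) :|: X1)|.
  rewrite -sum_nat_const; apply: leq_sum => x /setDP[xK nX1].
  rewrite card_nbrsIU //; apply: leq_trans (leq_addr _ _).
  have /orP[le1|le2] := Hm x xK; first by rewrite inE xK le1 in nX1.
  apply: leq_trans le2 _; apply: closed_nbrs clB _ (disjointC_set B).
  by case/clssP: xK => c fx cK'; rewrite (in_clss _ fx) (subsetP sKB).
have cX12 : #|X1| + #|X2| = 2 * s.
  rewrite -cK -(@card_clss_full _ _ f K s) => [|c cK']; last exact/fullB/(subsetP sKB).
  by rewrite -(cardsID X1 (clss f K)) (setIidPr sX1).
have cY : #|clss f (B :\: K)| = (#|B| - 2) * s.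
  rewrite (@card_clss_full _ _ f _ s) => [|c]; last by rewrite inE => /andP[_ /fullB].
  by rewrite cardsDS // cK.
rewrite cY in eY; move=> leE.
(* Each of the [2 * s] vertices coloured from [K] yields at least [m] cut edges, and each vertex
   coloured from [B :\: K] at least [r - #|B|] edges to classes outside [B]. *)
suff: 2 * s * m + (#|B| - 2) * s * (r - #|B|) + 4 <= 2 * #|dom f| by nia.
rewrite -cX12 mulnDl; lia.
Qed.

End Counting.

(** * Adding one vertex *)

Lemma connect_uniq_path (T : finType) (e : rel T) a b : connect e a b ->
  exists q, [/\ path e a q, uniq (a :: q) & last a q = b].
Proof.
case/connectP=> q eq ->; case: (shortenP eq) => q' eq' uq' _.
by exists q'.
Qed.

Lemma closed_path (T : finType) (e : rel T) (K : {set T}) a q :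
  (forall c d, c \in K -> e c d -> d \in K) -> a \in K -> path e a q ->
  {subset a :: q <= K}.
Proof.
move=> clK; elim: q a => [|b q IHq] a aK /=; first by move=> _ c; rewrite inE => /eqP->.
case/andP=> ab bq c; rewrite inE => /predU1P[-> //|].
exact: IHq (clK a b aK ab) bq c.
Qed.

Section Step.
Variables (G : sgraph) (C : finType) (L : G -> {set C}) (r : nat).
Hypothesis classB : in_classB G.
Hypothesis listr : list_assignment r L.
Hypothesis r_ge9 : 9 <= r.
Hypothesis degr : forall x : G, #|nbrs x| <= r.

Variables (D : {set G}) (v : G) (s p : nat).
Hypothesis vD : v \notin D.
Hypothesis degv : #|nbrs v :&: D| <= 6.
Hypothesis ltD : #|D| < r * s.
Hypothesis ltp : p < r.

Implicit Types (f g : {ffun G -> option C}) (x y z : G) (c d : C) (K J P : {set C}).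

Definition full f : {set C} := [set c | #|cls f c| == s].

Definition balanced k f := [forall c, #|cls f c| <= s] && (#|full f| <= k).

(** The colourings of [D] that an induction on [#|D|] provides; under [stuck], the section refutes
    their existence. *)
Definition good f := [&& proper_col L f, dom f == D & balanced p f].

Hypothesis stuck : forall g, proper_col L g -> dom g = v |: D -> ~~ balanced p.+1 g.

Definition accessible f c := [exists d, connect (mv L f) c d && (#|cls f d| < s)].

Definition bad f : {set C} := [set c | ~~ accessible f c].

(** Only the first colour of the chain is required to lie in [K]; for closed [K] the whole chain
    stays there, as [reach_sub] shows. *)
Definition reach f y K : {set C} :=
  [set c | [exists c0 in K, free L f y c0 && connect (mv L f) c0 c]].

Lemma goodP f : reflect [/\ proper_col L f, dom f = D, forall c, #|cls f c| <= s & #|full f| <= p] (good f).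
Proof.
apply: (iffP and3P) => [[fP /eqP fD /andP[/forallP fs fp]]|[fP -> fs fp]]; first by [].
by split=> //; rewrite /balanced fp andbT; apply/forallP.
Qed.

Lemma accessible_lt f c : #|cls f c| < s -> accessible f c.
Proof. by move=> lt; apply/existsP; exists c; rewrite connect0. Qed.

Lemma accessible_mv f c d : mv L f c d -> accessible f d -> accessible f c.
Proof.
move=> cd /existsP[e /andP[de lt]]; apply/existsP; exists e.
by rewrite lt (connect_trans (connect1 cd)).
Qed.

Lemma bad_closed f : closed_colors L f (bad f).
Proof. by move=> c d; rewrite !inE => nc cd; apply: contra nc; apply: accessible_mv. Qed.

Lemma bad_full f c : good f -> c \in bad f -> #|cls f c| = s.
Proof.
case/goodP=> _ _ fs _; rewrite inE => nc; apply/eqP; rewrite eqn_leq fs leqNgt.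
by apply: contra nc; apply: accessible_lt.
Qed.

Lemma card_bad f : good f -> #|bad f| < r.
Proof.
move=> fG; case/goodP: (fG) => _ _ _ fp; apply: leq_ltn_trans ltp.
apply: leq_trans fp; apply/subset_leq_card/subsetP=> c cB.
by rewrite inE (bad_full fG cB).
Qed.

Lemma reach_closed f y K : closed_colors L f (reach f y K).
Proof.
move=> c d; rewrite !inE => /exists_inP[c0 c0K /andP[yc0 c0c]] cd.
by apply/exists_inP; exists c0; rewrite // yc0 (connect_trans c0c) ?connect1.
Qed.

Lemma reachP f y K c : reflect
  (exists c0 q, [/\ c0 \in K, free L f y c0, path (mv L f) c0 q, uniq (c0 :: q) & last c0 q = c])
  (c \in reach f y K).
Proof.
rewrite inE; apply: (iffP exists_inP) => [[c0 c0K /andP[yc0 /connect_uniq_path[q [? ? ?]]]]|].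
  by exists c0, q.
move=> [c0 [q [c0K yc0 c0q _ qc]]]; exists c0; rewrite // yc0 /=.
by apply/connectP; exists q.
Qed.

Lemma reach_sub f y K : closed_colors L f K -> reach f y K \subset K.
Proof.
move=> clK; apply/subsetP=> c /reachP[c0 [q [c0K _ c0q _ <-]]].
exact: (closed_path clK c0K c0q (mem_last _ _)).
Qed.

(** Inserting [v] along the chain changes the size of the last class only, so balanced resulting
    sizes contradict [stuck]. *)
Lemma no_insertion f c q : proper_col L f -> dom f = D -> free L f v c ->
    path (mv L f) c q -> uniq (c :: q) ->
    (forall e, #|cls f e| + (e == last c q) <= s) ->
  ~~ (#|[set e | #|cls f e| + (e == last c q) == s]| <= p.+1).
Proof.
move=> fP fD vc cq cq_uniq fs; apply/negP => fp.
have fv : f v = None by apply/eqP; move: vD; rewrite -fD inE; case: (f v).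
have [g [gP gD gcard _]] := insert_path fP fv vc cq cq_uniq.
have /negP[] := stuck gP (etrans gD (congr1 _ fD)).
apply/andP; split; first by apply/forallP=> c'; rewrite gcard.
apply: leq_trans fp; apply/subset_leq_card/subsetP=> c'.
by rewrite !inE gcard.
Qed.

(** From an accessible class a chain leads to some class [d] smaller than [s]. Inserting [v] along
    it makes at most [d] newly full, so at most [p.+1] classes are full. *)
Lemma free_v_bad f c : good f -> free L f v c -> c \in bad f.
Proof.
case/goodP=> fP fD fs fp vc; rewrite inE; apply/negP=> /existsP[d].
case/andP=> /connect_uniq_path[q [cq cq_uniq qd]] lt_ds.
have := no_insertion fP fD vc cq cq_uniq; rewrite qd => H.
have lt_s e : #|cls f e| + (e == d) <= s by case: eqP => [->|_]; rewrite ?addn1 ?addn0.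
case/negP: (H lt_s).
apply: (@leq_trans #|d |: full f|); last by rewrite cardsU1 -add1n leq_add ?leq_b1.
apply/subset_leq_card/subsetP=> e; rewrite !inE; case: (e =P d) => //= _.
by rewrite addn0.
Qed.

Lemma large_or_small f K : good f -> K \subset bad f -> closed_colors L f K ->
  (#|K| <= 2) || (r - 2 <= #|K|).
Proof.
move=> fG sK clK; apply: (closed_count classB listr r_ge9 (s := s)) clK.
  by case/goodP: fG => _ ->.
by move=> c /(subsetP sK); apply: bad_full.
Qed.

(** At most 6 colours of [L v] are blocked, so at least [r - 6 >= 3] are free for [v], and these are
    bad by [free_v_bad]. A closed set of 3 or more bad colours is large. *)
Lemma reach_v_large f : good f -> r - 2 <= #|reach f v (bad f)|.
Proof.
move=> fG; have := large_or_small fG (reach_sub v (@bad_closed f)) (@reach_closed f v _).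
suff le3 : 3 <= #|reach f v (bad f)| by lia.
pose K := [set c | ~~ free L f v c].
have : #|L v :&: K| <= #|nbrs v :&: clss f setT|.
  by apply: card_nbrs_clss => [c _|c _]; rewrite inE.
have -> : clss f setT = D.
  case/goodP: fG => _ <- _ _; apply/setP=> x; rewrite !inE.
  by case: (f x) => // c; rewrite inE.
have : #|L v :&: ~: K| <= #|reach f v (bad f)|.
  apply/subset_leq_card/subsetP=> c; rewrite !inE negbK => /andP[_ vc].
  apply/exists_inP; exists c; last by rewrite vc connect0.
  exact: free_v_bad.
by have := card_list_split listr v K; lia.
Qed.

(** * Exchanges around a vertex of large weight *)

Section Core.
Variables (f : {ffun G -> option C}) (P : {set C}) (y : G) (c : C).
Hypothesis fG : good f.
Hypothesis minf : forall g, good g -> #|bad f| <= #|bad g|.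
Hypothesis P_bad : P \subset bad f.
Hypothesis P_large : r - 2 <= #|P|.
Hypothesis P_min : forall K, K \subset bad f -> closed_colors L f K -> r - 2 <= #|K| -> P \subset K.
Hypothesis fy : f y = Some c.
Hypothesis c_bad : c \notin bad f.
Hypothesis nbad_lt : forall d, d \notin bad f -> d != c -> #|cls f d| < s.
(** Keeps class [c] accessible after an exchange even if it is full: one of its vertices can move on
    to another class outside [bad f]. *)
Hypothesis c_acc : #|cls f c| < s \/
  exists z d, [/\ f z = Some c, free L f z d, d != c & d \notin bad f].

Let S := solo L f (clss f P) y.

Let fP : proper_col L f. Proof. by case/goodP: fG. Qed.
Let fD : dom f = D. Proof. by case/goodP: fG. Qed.
Let fs d : #|cls f d| <= s. Proof. by case/goodP: fG. Qed.
Let fp : #|full f| <= p. Proof. by case/goodP: fG. Qed.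

Lemma soloP x : reflect
  (exists2 d, d \in P & [/\ f x = Some d, c \in L x & nbrs x :&: cls f c = [set y]])
  (x \in S).
Proof.
rewrite !inE fy; apply: (iffP and3P).
  by case; case fx: (f x) => [d|//] dP cL /eqP E; exists d.
by move=> [d dP [-> cL ->]].
Qed.

Definition swap x := upd (upd f y None) x (Some c).

(** Properness holds because [y] is the only neighbour of [x] in class [c]. That class trades [y]
    for [x], so only the former class of [x] shrinks. *)
Lemma swap_facts x d : x \in S -> f x = Some d ->
  [/\ proper_col L (swap x), x != y, dom (swap x) = D :\ y, swap x y = None
    & forall e, #|cls (swap x) e| + (e == d) = #|cls f e|].
Proof.
case/soloP=> d' d'P [fx cL xN] fx'; move: fx'; rewrite fx => -[Ed]; subst d'.
have dc : d != c by apply: contraNneq c_bad => <-; apply: (subsetP P_bad).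
have xy : x != y by apply: contra_neq dc => E; move: fx; rewrite E fy => -[].
split=> //.
- apply: proper_col_upd; first exact: proper_col_clear.
  apply/freeP; split=> // w xw; rewrite updE; case: eqP => // wy fw.
  by have : w \in [set y]; [rewrite -xN !inE xw fw eqxx | rewrite inE => /eqP].
- rewrite !dom_upd fD /=; apply/setP=> w; rewrite !inE.
  by case: (w =P x) => [->|//]; rewrite xy -fD inE fx.
- by rewrite !updE eq_sym (negPf xy) eqxx.
- move=> e; have := card_cls_upd (upd f y None) x (Some c) e.
  have := card_cls_upd f y None e; rewrite -/(swap x) updE (negPf xy) fy fx.
  by rewrite !(inj_eq Some_inj) (eq_sym e) addn0 => -> ->.
Qed.

Lemma cls_swap x e : e != c -> cls (swap x) e \subset cls f e.
Proof.
move=> ec; rewrite !cls_upd (inj_eq Some_inj) eq_sym (negPf ec) /=.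
by apply: subset_trans (subsetDl _ _) (subsetDl _ _).
Qed.

Lemma nbadE e : e \in bad f -> e != c.
Proof. by apply: contraTneq => ->. Qed.

(** Only class [c] gains a vertex, and it is off the path because it is not bad. The vertex [x]
    leaves the last class, which sends out nothing. *)
Lemma swap_path x d c0 q : f x = Some d -> c0 \in bad f -> path (mv L f) c0 q ->
  uniq (c0 :: q) -> last c0 q = d -> path (mv L (swap x)) c0 q.
Proof.
move=> fx c0B c0q c0q_uniq qd; have sB := closed_path (@bad_closed f) c0B c0q.
apply: path_transfer c0q_uniq c0q _ _ => [w e /sB eB ed fw|e /sB/nbadE]; last exact: cls_swap.
rewrite !updE; case: eqP => [wx|_].
  by move: ed; rewrite qd; move: fw; rewrite wx fx => -[->]; rewrite eqxx.
by case: eqP => // wy; move: fw (nbadE eB); rewrite wy fy => -[->]; rewrite eqxx.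
Qed.

(** Otherwise [y] moves to [d] and [x] replaces it in [c], leaving a gap in the class of [x]. By
    minimality of [P], [v] reaches every colour of [P], hence that gap; after the insertion only [d]
    has grown, against [stuck]. *)
Lemma solo_stays x d : x \in S -> d \notin bad f -> d != c -> ~~ free L f y d.
Proof.
move=> xS dB dc; apply/negP=> yd.
have [a aP [fx cL xN]] := soloP x xS.
have [gP xy gD gy gcard] := swap_facts xS fx.
have PR : P \subset reach f v (bad f).
  apply: P_min (reach_v_large fG); first exact/reach_sub/bad_closed.
  exact: reach_closed.
have /reachP[c0 [q [c0B vc0 c0q c0q_uniq qa]]] := subsetP PR a aP.
have sB := closed_path (@bad_closed f) c0B c0q.
have B_d e : e \in bad f -> e != d by apply: contraTneq => ->.
pose g := upd (swap x) y (Some d).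
have clsg e : e \in bad f -> cls g e \subset cls (swap x) e.
  by move=> /B_d ed; rewrite cls_upd (inj_eq Some_inj) eq_sym (negPf ed) subsetDl.
have cardg e : #|cls g e| + (e == a) = #|cls f e| + (e == d).
  have : #|cls g e| + (swap x y == Some e) = #|cls (swap x) e| + (Some d == Some e).
    exact: card_cls_upd.
  by rewrite gy (inj_eq Some_inj) (eq_sym d) addn0 -(gcard e) => ->; rewrite addnAC.
have gpath : path (mv L g) c0 q.
  apply: path_transfer c0q_uniq (swap_path fx c0B c0q c0q_uniq qa) _ _ => [w e _ _ gw|e /sB /clsg //].
  by rewrite /g updE; case: eqP gw => // ->; rewrite gy.
have g1 : proper_col L g.
  apply: proper_col_upd gP _; apply: free_sub yd; exact: cls_swap.
have g2 : dom g = D.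
  by rewrite dom_upd gD /= setD1K // -fD inE fy.
have g3 : free L g v c0.
  apply: free_sub vc0; apply: subset_trans (clsg _ c0B) _.
  exact/cls_swap/nbadE.
have := no_insertion g1 g2 g3 gpath c0q_uniq; rewrite qa => H.
have lt_s e : #|cls g e| + (e == a) <= s.
  by rewrite cardg; case: eqP => [->|_]; rewrite ?addn0 ?addn1 // nbad_lt.
case/negP: (H lt_s).
apply: (@leq_trans #|d |: full f|); last by rewrite cardsU1 -add1n leq_add ?leq_b1.
apply/subset_leq_card/subsetP=> e; rewrite !inE cardg; case: (e =P d) => //= _.
by rewrite addn0.
Qed.

(* Moving [x] to the class of [y], and [y] along the path to the old class of
   [x], makes [z] movable to a class outside [bad f]. *)
Lemma no_exchange x z d c0 q : x \in S -> z \in S -> z != x -> ~~ adj x z ->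
    f x = Some d -> c0 \in bad f -> free L (swap x) y c0 ->
    path (mv L f) c0 q -> uniq (c0 :: q) -> last c0 q = d -> False.
Proof.
move=> xS zS zx nxz fx c0B yc0 c0q c0q_uniq qd.
have sB := closed_path (@bad_closed f) c0B c0q.
have [gP xy gD gy gcard] := swap_facts xS fx.
have gpath := swap_path fx c0B c0q c0q_uniq qd.
have [g [g1 g2 g3 g4]] := insert_path gP gy yc0 gpath c0q_uniq.
have g4' e : e \notin bad f -> cls g e = cls (swap x) e.
  by move=> eB; apply: g4; apply: contra eB => /sB.
have cardg e : #|cls g e| = #|cls f e| by rewrite g3 qd gcard.
have gG : good g.
  apply/goodP; split=> //; first by rewrite g2 gD setD1K // -fD inE fy.
    by move=> e; rewrite cardg.
  by apply: leq_trans fp; apply/subset_leq_card/subsetP=> e; rewrite !inE cardg.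
have clsc : cls g c = x |: (cls f c :\ y).
  by rewrite g4' // !cls_upd eqxx.
have clsN e : e \notin bad f -> e != c -> cls g e = cls f e :\ y :\ x.
  by move=> eB ec; rewrite g4' // !cls_upd (inj_eq Some_inj) eq_sym (negPf ec).
have accN e : e \notin bad f -> e != c -> accessible g e.
  by move=> eB ec; apply: accessible_lt; rewrite cardg nbad_lt.
(* In the second case of [c_acc] the vertex [w] is still in class [c]: it differs from [y], to which
   [solo_stays] forbids that move. *)
have accc : accessible g c.
  case: c_acc => [lt|[w [e [fw we ec eB]]]]; first by apply: accessible_lt; rewrite cardg.
  apply: (@accessible_mv _ _ e); last exact: accN.
  apply/exists_inP; exists w.
    have wy : w != y.
      by apply: contraNneq (solo_stays xS eB ec) => <-.
    by rewrite clsc !inE wy fw eqxx orbT.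
  by apply: free_sub we; rewrite clsN //; apply: subset_trans (subsetDl _ _) (subsetDl _ _).
have sub : bad g \subset bad f.
  apply/subsetP=> e; apply: contraLR => eB; rewrite inE negbK.
  by have [->|] := eqVneq e c; [exact: accc | exact: accN].
have [a aP [fz cLz zN]] := soloP z zS.
have : z \in dom g by rewrite g2 gD setD1K -fD ?inE ?fy // fz.
(* The chain may have recoloured [z], but its new colour [b] is still in [bad f]. As [z] can now
   move to [c], [b] is not in [bad g]. *)
rewrite inE; case gz: (g z) => [b|//] _.
have zy : z != y.
  by apply: contraNneq c_bad => E; move: fz; rewrite E fy => -[->]; apply: (subsetP P_bad).
have bB : b \in bad f.
  apply: contraT => bB; have : z \in cls g b by rewrite inE gz.
  have [bc|bc] := eqVneq b c.
    rewrite bc clsc !inE (negPf zx) zy /= fz => /eqP[ac].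
    by case/negP: c_bad; rewrite -ac (subsetP P_bad).
  rewrite clsN // !inE fz => /and3P[_ _ /eqP[ab]].
  by rewrite -ab (subsetP P_bad) in bB.
have := minf gG; rewrite leqNgt => /negP[]; apply: proper_card.
rewrite properE sub; apply/subsetPn; exists b => //; rewrite inE negbK.
apply: (@accessible_mv _ _ c) => //; apply/exists_inP; exists z; first by rewrite inE gz.
rewrite /free cLz clsc -setI_eq0; apply/eqP/setP=> w; rewrite !inE.
apply/negP=> /andP[zw /orP[/eqP wx|/andP[wy fw]]].
  by rewrite -wx adj_sym zw in nxz.
have : w \in nbrs z :&: cls f c by rewrite !inE zw.
by rewrite zN inE (negPf wy).
Qed.

Let R := reach f y (bad f).
Let U := undominating S.

Lemma undominatingP x : x \in U -> exists2 z, z \in S & (z != x) && ~~ adj x z.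
Proof. by rewrite inE => /andP[_ /exists_inP[z zS zx]]; exists z. Qed.

Lemma U_sub x : x \in U -> x \in S.
Proof. by rewrite inE => /andP[]. Qed.

(** A chain from [y] to the class of [x] would be an exchange, with a non-neighbour of [x] in [S] as
    the second solo vertex. *)
Lemma U_notin_reach x d : x \in U -> f x = Some d -> d \notin R.
Proof.
move=> xU fx; apply/negP=> /reachP[c0 [q [c0B yc0 c0q c0q_uniq qd]]].
have [z zS /andP[zx nxz]] := undominatingP xU.
apply: (no_exchange (U_sub xU) zS zx nxz fx c0B _ c0q c0q_uniq qd).
by apply: free_sub yc0; apply/cls_swap/nbadE.
Qed.

(** If [x] were the only neighbour of [y] in class [d], then [y] could take its place directly: an
    exchange whose chain has a single class. *)
Lemma U_two_nbrs x d : x \in U -> f x = Some d -> d \in L y ->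
  1 < #|nbrs y :&: cls f d|.
Proof.
move=> xU fx dL; rewrite ltnNge; apply/negP=> le1.
have [z zS /andP[zx nxz]] := undominatingP xU; have xS := U_sub xU.
have [d' dP [fx' cL xN]] := soloP x xS.
move: fx'; rewrite fx => -[E]; rewrite -{}E in dP.
have dB : d \in bad f by apply: (subsetP P_bad).
apply: (no_exchange xS zS zx nxz fx dB (q := [::])) => //.
rewrite /free dL -setI_eq0; apply/eqP/setP=> w; rewrite !inE updE.
apply/negP=> /andP[yw]; case: (w =P x) => [_ /eqP[cd]|/eqP wx].
  by rewrite -cd (negPf c_bad) in dB.
rewrite updE; case: (w =P y) => // _ fw.
have yx : adj y x.
  have : y \in nbrs x :&: cls f c by rewrite xN inE.
  by rewrite !inE adj_sym => /andP[].
have /card_le1_eqP/(_ w x) := le1; rewrite !inE yw fw yx fx eqxx => /(_ isT isT) E.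
by rewrite E eqxx in wx.
Qed.

Hypothesis wy : 2 * r - 3 <= weight L f (clss f P) y.

Lemma card_S : r - 3 <= #|S|.
Proof.
move: wy; rewrite /weight -/S.
have := subset_leq_card (subsetIl (nbrs y) (clss f P)); have := degr y; lia.
Qed.

Lemma S_nbrs : S \subset nbrs y.
Proof. by apply: subset_trans (solo_nbrs _ _ _ _) (subsetIl _ _). Qed.

Lemma card_U : 5 <= #|U|.
Proof. by have := card_undominating classB S_nbrs; have := card_S; rewrite -/S -/U; lia. Qed.

Lemma U_clss : U \subset clss f (bad f).
Proof.
apply/subsetP=> x /U_sub/soloP[d dP [fx _ _]].
by rewrite (in_clss _ fx) (subsetP P_bad).
Qed.

Lemma c_Ly : c \in L y.
Proof. by have /proper_colP/(_ y c fy)/freeP[] := fP. Qed.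

(** By [solo_stays], each colour of [L y] outside [bad f] other than [c] costs [y] a neighbour. As
    [y] has at most [r = #|L y|] neighbours, the bad classes get at most one more than
    [#|L y :&: bad f|], the excess being due to [c]. *)
Lemma card_nbrs_bad : #|nbrs y :&: clss f (bad f)| <= #|L y :&: bad f| + 1.
Proof.
have [x xU] : exists x, x \in U by apply/card_gt0P; have := card_U; lia.
have le1 : #|L y :&: (~: bad f :\ c)| <= #|nbrs y :&: clss f (~: bad f)|.
  apply: card_nbrs_clss => [d|d _]; rewrite !inE; first by case/andP.
  by case/andP=> dc dB; apply: solo_stays (U_sub xU) _ dc; rewrite inE.
have := card_list_split listr y (bad f).
have := cardsD1 c (L y :&: ~: bad f).
have -> : (L y :&: ~: bad f) :\ c = L y :&: (~: bad f :\ c) by rewrite setIDA.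
have -> : c \in L y :&: ~: bad f by rewrite in_setI in_setC c_Ly c_bad.
have := degr y.
have : #|nbrs y :&: clss f (bad f)| + #|nbrs y :&: clss f (~: bad f)| <= #|nbrs y|.
  rewrite -card_nbrsIU ?disjoint_clss ?disjointC_set //.
  exact/subset_leq_card/subsetIl.
by lia.
Qed.

Let kappa := #|[set d in L y :&: bad f | #|nbrs y :&: cls f d| == 0]|.

Lemma kappa_reach : kappa <= #|R|.
Proof.
apply/subset_leq_card/subsetP=> d; rewrite !inE -andbA => /and3P[dL dB].
rewrite cards_eq0 setI_eq0 => dis.
by apply/exists_inP; exists d; rewrite ?inE // /free dL dis connect0.
Qed.

(** Summed over the bad colours. A colour of [L y] whose class meets [U] falls under the hypothesis;
    any other colour of [L y] costs a neighbour of [y] or is counted by [kappa]. [card_nbrs_bad]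
    bounds the total. *)
Lemma count_U a b : (forall d, d \in bad f -> d \in L y -> 0 < #|U :&: cls f d| ->
      a * #|U :&: cls f d| + b <= b * #|nbrs y :&: cls f d|) -> a <= b ->
  a * #|U| <= b * (1 + kappa).
Proof.
move=> Hd le_ab.
have : a * #|U| + b * #|L y :&: bad f| <=
    b * #|nbrs y :&: clss f (bad f)| + b * kappa.
  have -> : #|L y :&: bad f| = \sum_(d in bad f) (d \in L y).
    by rewrite -card_set_sum; apply: eq_card => d; rewrite !inE andbC.
  have -> : kappa = \sum_(d in bad f) ((d \in L y) && (#|nbrs y :&: cls f d| == 0)).
    by rewrite -card_set_sum; apply: eq_card => d; rewrite !inE andbCA andbA.
  rewrite -{1}(setIidPl U_clss) !card_clssI.
  rewrite !big_distrr -!big_split; apply: leq_sum => d dB /=.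
  have sUN : #|U :&: cls f d| <= #|nbrs y :&: cls f d|.
    apply/subset_leq_card/setSI; apply: subset_trans S_nbrs.
    by apply/subsetP=> x; apply: U_sub.
  have := Hd d dB; case: (d \in L y) => [/(_ isT)|_]; last by nia.
  case: (posnP #|U :&: cls f d|) => [->|_ /(_ isT)]; last by lia.
  by move=> _; case: eqP => [->|]; nia.
have := card_nbrs_bad; nia.
Qed.

(** A large [R] would contain [P], hence the colour of a vertex of [U], against [U_notin_reach]. *)
Lemma R_small : #|R| <= 2.
Proof.
have [x xU] : exists x, x \in U by apply/card_gt0P; have := card_U; lia.
have sR : R \subset bad f by apply/reach_sub/bad_closed.
have clR : closed_colors L f R by apply: reach_closed.
have /orP[//|leR] := large_or_small fG sR clR.
have /soloP[d dP [fx _ _]] := U_sub xU.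
by have := U_notin_reach xU fx; rewrite (subsetP (P_min sR clR leR)).
Qed.

(** With at most one colour in [R], [kappa <= 1]. By [U_two_nbrs] the coefficients 1 and 2 are
    admissible in [count_U], which gives [#|U| <= 4]. *)
Lemma R_card2 : #|R| = 2.
Proof.
apply/eqP; rewrite eqn_leq R_small ltnNge; apply/negP=> leR.
have := @count_U 1 2; rewrite mul1n => H.
suff : #|U| <= 2 * (1 + kappa) by have := kappa_reach; have := card_U; lia.
apply: H => // d dB dL /card_gt0P[x]; rewrite inE => /andP[xU]; rewrite inE => /eqP fx.
have := U_two_nbrs xU fx dL.
suff : #|U :&: cls f d| <= #|nbrs y :&: cls f d| by lia.
apply/subset_leq_card/setSI; apply: subset_trans S_nbrs.
by apply/subsetP=> z; apply: U_sub.
Qed.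

(** Moving [x1] and [x2] into [c] and [y] into [d] enlarges [c] by one, for which there is room, and
    shrinks [d]. Then [d] is no longer bad, against the minimality of [bad f]. *)
Lemma no_double d x1 x2 : #|cls f c| + 1 < s -> d \in bad f -> d \in L y ->
  x1 \in S -> x2 \in S -> x1 != x2 -> nbrs y :&: cls f d = [set x1; x2] -> False.
Proof.
move=> ltc dB dL x1S x2S x12 yN.
have dc := nbadE dB.
have Nx x : x \in S -> nbrs x :&: cls f c = [set y] by case/soloP=> ? _ [].
have cLx x : x \in S -> c \in L x by case/soloP=> ? _ [].
have xP x : x \in [set x1; x2] -> adj y x /\ f x = Some d.
  by rewrite -yN !inE => /andP[-> /eqP].
have [yx1 fx1] := xP x1 (set21 _ _); have [yx2 fx2] := xP x2 (set22 _ _).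
have x1y : x1 != y by apply: contra_neq dc => E; move: fx1; rewrite E fy => -[].
have x2y : x2 != y by apply: contra_neq dc => E; move: fx2; rewrite E fy => -[].
have nx12 : ~~ adj x2 x1.
  apply/negP=> x21; have /proper_colP/(_ x2 d fx2)/freeP[_ /(_ x1 x21)] := fP.
  by rewrite fx1.
pose f1 := upd f y None; pose f2 := upd f1 x1 (Some c).
pose f3 := upd f2 x2 (Some c); pose g := upd f3 y (Some d).
have p1 : proper_col L f1 by apply: proper_col_clear.
have solo_free x w : x \in S -> adj x w -> w != y -> f w <> Some c.
  move=> xS xw wy' fw; have : w \in nbrs x :&: cls f c by rewrite !inE xw fw eqxx.
  by rewrite Nx // inE (negPf wy').
have p2 : proper_col L f2.
  apply: proper_col_upd => //; apply/freeP; split=> [|w xw]; first exact: cLx.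
  by rewrite updE; case: (w =P y) => // /eqP; apply: solo_free x1S xw.
have p3 : proper_col L f3.
  apply: proper_col_upd => //; apply/freeP; split=> [|w xw]; first exact: cLx.
  rewrite !updE; case: (w =P x1) => [wx|_]; first by rewrite -wx xw in nx12.
  by case: (w =P y) => // /eqP; apply: solo_free x2S xw.
have p4 : proper_col L g.
  apply: proper_col_upd => //; apply/freeP; split=> // w yw; rewrite !updE.
  case: (w =P x2) => [_ [cd]|/eqP wx2]; first by rewrite cd eqxx in dc.
  case: (w =P x1) => [_ [cd]|/eqP wx1]; first by rewrite cd eqxx in dc.
  case: (w =P y) => // _ fw; have : w \in nbrs y :&: cls f d by rewrite !inE yw fw eqxx.
  by rewrite yN !inE (negPf wx1) (negPf wx2).
have gD : dom g = D.
  rewrite !dom_upd fD /=; apply/setP=> w; rewrite !inE.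
  case: (w =P y) => [->|_] /=; first by rewrite -fD inE fy.
  case: (w =P x2) => [->|_] /=; first by rewrite -fD inE fx2.
  by case: (w =P x1) => [->|_] //=; rewrite -fD inE fx1.
have gcard e : #|cls g e| + (e == d) = #|cls f e| + (e == c).
  have f1x1 : f1 x1 = Some d by rewrite updE (negPf x1y).
  have f2x2 : f2 x2 = Some d by rewrite !updE eq_sym (negPf x12) (negPf x2y).
  have f3y : f3 y = None by rewrite !updE ![y == _]eq_sym (negPf x1y) (negPf x2y) eqxx.
  have e1 : #|cls f1 e| + (f y == Some e) = #|cls f e| + (None == Some e).
    exact: card_cls_upd.
  have e2 : #|cls f2 e| + (f1 x1 == Some e) = #|cls f1 e| + (Some c == Some e).
    exact: card_cls_upd.
  have e3 : #|cls f3 e| + (f2 x2 == Some e) = #|cls f2 e| + (Some c == Some e).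
    exact: card_cls_upd.
  have e4 : #|cls g e| + (f3 y == Some e) = #|cls f3 e| + (Some d == Some e).
    exact: card_cls_upd.
  move: e1 e2 e3 e4; rewrite f1x1 f2x2 f3y fy !(inj_eq Some_inj) !(eq_sym _ e) !addn0.
  move: #|cls g e| #|cls f3 e| #|cls f2 e| #|cls f1 e| #|cls f e| => n4 n3 n2 n1 n0.
  by case: (e == c); case: (e == d) => /=; clear; lia.
clearbody g; clear f1 f2 f3 p1 p2 p3.
have glt e : e \notin bad f :\ d -> #|cls g e| < s.
  rewrite inE inE negb_and negbK => /orP[/eqP->|eB].
    by have := gcard d; have := fs d; rewrite eqxx (negPf dc) addn0 addn1 => ? ->.
  have ed : e != d by apply: contraNneq eB => ->.
  have := gcard e; rewrite (negPf ed) addn0 => ->.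
  have [->|ec] := eqVneq e c; first exact: ltc.
  by rewrite addn0 nbad_lt.
have gG : good g.
  apply/goodP; split=> // [e|].
    have [eB|/glt/ltnW //] := boolP (e \in bad f :\ d).
    move: eB; rewrite !inE => /andP[ed eB]; have := gcard e.
    have ec : e != c by apply: nbadE; rewrite inE.
    by rewrite (negPf ed) (negPf ec) !addn0 => ->.
  apply: leq_trans fp; apply: leq_trans (_ : #|bad f| <= _); last first.
    by apply/subset_leq_card/subsetP=> e eB; rewrite inE (bad_full fG eB).
  apply: leq_trans (subset_leq_card (subsetDl _ [set d])).
  apply/subset_leq_card/subsetP=> e; rewrite inE; apply: contraTT => /glt.
  by rewrite ltn_neqAle => /andP[].
have := minf gG; rewrite leqNgt => /negP[].
apply: leq_ltn_trans (_ : #|bad f :\ d| < _); last by rewrite [X in _ < X](cardsD1 d) dB.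
apply/subset_leq_card/subsetP=> e; rewrite inE; apply: contraR => /glt.
exact: accessible_lt.
Qed.

Lemma core : False.
Proof.
have sR : R \subset bad f by apply/reach_sub/bad_closed.
have clR : closed_colors L f R by apply: reach_closed.
have fullB e : e \in bad f -> #|cls f e| = s by apply: bad_full.
have ltf : #|dom f| < r * s by rewrite fD.
have lt_br := card_bad fG.
have le_b : r - 2 <= #|bad f| by apply: leq_trans P_large (subset_leq_card P_bad).
have b4 : 4 < #|bad f| by lia.
have splitR x : r <= #|L x :&: (bad f :\: R)| + #|L x :&: ~: bad f| + 2.
  have := card_list_split listr x (bad f); rewrite -R_card2.
  have := cardsID R (L x :&: bad f); rewrite setIDA.
  by have := subset_leq_card (subsetIr (L x :&: bad f) R); lia.
have cut m := closed_pair_cut classB listr r_ge9 (m := m) ltf lt_br b4 fullB sR R_card2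
  (@bad_closed f) clR.
have [b2|b2] := eqVneq #|bad f| (r - 2).
  (* The two parts of each list have at least [r - 2 >= 7] colours together, so one of them has 4.
     The cut bound then reads [2 * r * s < 2 * r * s]. *)
  have := cut 4; rewrite b2 => H.
  suff : s * (2 * 4 + (r - 2 - 2) * (r - (r - 2))) < 2 * (r * s) by nia.
  by apply: H => x _; have := splitR x; lia.
have b1 : #|bad f| = r - 1 by lia.
have [ltc|lec] := ltnP (#|cls f c| + 1) s.
  (* [no_double] excludes that a class has exactly two neighbours of [y], both in [U]; this makes 2
     and 3 admissible. Then [2 * #|U| <= 9], while [#|U| >= 5]. *)
  have := @count_U 2 3 => H.
  suff : 2 * #|U| <= 3 * (1 + kappa).
    by have := kappa_reach; have := card_U; rewrite R_card2; lia.
  apply: H => // d dB dL /card_gt0P[x]; rewrite inE => /andP[xU]; rewrite inE => /eqP fx.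
  have le2 := U_two_nbrs xU fx dL.
  have sUN : U :&: cls f d \subset nbrs y :&: cls f d.
    apply/setSI; apply: subset_trans S_nbrs.
    by apply/subsetP=> z; apply: U_sub.
  have leUN := subset_leq_card sUN.
  have [eq2|] := eqVneq #|nbrs y :&: cls f d| 2; last by move: le2 leUN; clear; lia.
  have [le1|gt1] := leqP #|U :&: cls f d| 1; first by rewrite eq2; move: le1; clear; lia.
  have E : U :&: cls f d = nbrs y :&: cls f d.
    by apply/eqP; rewrite eqEcard sUN eq2 gt1.
  have /cards2P[x1 [x2 [x12 yN]]] := introT eqP eq2.
  case: (@no_double d x1 x2) => //.
    have : x1 \in U :&: cls f d by rewrite E yN set21.
    by rewrite inE => /andP[/U_sub].
  have : x2 \in U :&: cls f d by rewrite E yN set22.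
  by rewrite inE => /andP[/U_sub].
(* Now class [c] has at least [s - 1] vertices, and the [r - 1] bad classes leave fewer than [s], so
   [c] is the only nonempty class outside [bad f]. *)
have QE : clss f (~: bad f) = cls f c.
  apply/esym/eqP; rewrite eqEcard -cls1; apply/andP; split.
    apply/subsetP=> x /clssP[e fx]; rewrite (in_clss _ fx) !inE => /eqP->.
    by move: c_bad; rewrite inE.
  rewrite cls1; have := ltf; rewrite -(clssC f (bad f)) cardsU.
  rewrite (disjoint_setI0 (disjoint_clss f (disjointC_set _))) cards0 subn0.
  rewrite (card_clss_full fullB) b1; nia.
(* Outside [bad f], the list of a vertex coloured from [R] contains at most [c], which permits
   [m = r - 3]. The cut bound becomes [3 * (r - 3) * s < 2 * r * s], false for [r >= 9]. *)
have := cut (r - 3); rewrite b1 => H.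
suff : s * (2 * (r - 3) + (r - 1 - 2) * (r - (r - 1))) < 2 * (r * s) by nia.
apply: H => x xR; have := splitR x.
suff : #|L x :&: ~: bad f| <= 1 by lia.
rewrite -(cards1 c); apply/subset_leq_card/subsetP=> e; rewrite in_setI in_setC => /andP[eL eB].
rewrite inE; case/clssP: xR => d fx dR.
have := nfreeP eL (closed_nfree (@bad_closed f) fx (subsetP sR d dR) eB).
case/card_gt0P=> w; rewrite !inE => /andP[_ /eqP fw].
have : w \in cls f c by rewrite -QE (in_clss _ fw) inE.
by rewrite inE fw.
Qed.

End Core.

(** * Finding a vertex of large weight *)

Lemma bad_large f : good f -> r - 2 <= #|bad f|.
Proof.
move=> fG; apply: leq_trans (reach_v_large fG) _.
exact/subset_leq_card/reach_sub/bad_closed.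
Qed.

(* Two large closed sets of bad colours meet in a closed set that is again
   large, so there is a least one. *)
Lemma exists_core_colors f : good f -> exists P, [/\ P \subset bad f, r - 2 <= #|P|
  & forall K, K \subset bad f -> closed_colors L f K -> r - 2 <= #|K| -> P \subset K].
Proof.
move=> fG.
pose ok K := [&& K \subset bad f, r - 2 <= #|K|
  & [forall c, forall d, (c \in K) ==> mv L f c d ==> (d \in K)]].
have okP K : reflect [/\ K \subset bad f, r - 2 <= #|K| & closed_colors L f K] (ok K).
  apply: (iffP and3P) => -[sK leK clK]; split=> //.
    by move=> c d cK cd; have /forallP/(_ c)/forallP/(_ d) := clK; rewrite cK cd.
  by apply/forallP=> c; apply/forallP=> d; apply/implyP=> cK; apply/implyP; apply: clK.
have okB : ok (bad f) by apply/okP; split; [|exact: bad_large|exact: bad_closed].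
case: (arg_minnP (fun K : {set C} => #|K|) okB) => P /okP[sP leP clP] minP.
exists P; split=> // K sK clK leK; have clKP := closedI clK clP.
have sKP : K :&: P \subset bad f by apply: subset_trans sP; apply: subsetIr.
suff leKP : r - 2 <= #|K :&: P|.
  have /eqP <- : K :&: P == P; last exact: subsetIl.
  by rewrite eqEcard subsetIr minP //; apply/okP.
(* Inclusion-exclusion gives [#|K :&: P| >= 2 * (r - 2) - (r - 1) = r - 3], which is more than 2. *)
have := large_or_small fG sKP clKP; have := cardsUI K P.
have : #|K :|: P| <= #|bad f| by apply: subset_leq_card; rewrite subUset sK.
by have := card_bad fG; lia.
Qed.

Lemma card_clssC f : good f -> #|clss f (~: bad f)| + #|bad f| * s = #|D|.
Proof.
move=> fG; rewrite -(card_clss_full (fun c => @bad_full f c fG)).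
case/goodP: fG => _ <- _ _; rewrite -(clssC f (bad f)) cardsU.
by rewrite (disjoint_setI0 (disjoint_clss f (disjointC_set _))) cards0 subn0 addnC.
Qed.

Lemma exists_heavy (A : {set G}) f (X : {set G}) k :
  #|A| * k < \sum_(y in A) weight L f X y -> exists2 y, y \in A & k < weight L f X y.
Proof.
rewrite ltnNge => /negP big; case: (pickP [pred y in A | k < weight L f X y]) => [y /andP[]|small].
  by exists y.
case: big; rewrite -sum_nat_const; apply: leq_sum => y yA.
by have := small y; rewrite /= yA /= ltnNge => /negbFE.
Qed.

(** Averaging: with [b = #|bad f|], the weights add up to at least [2 * #|P| * s * (r - b)] over
    fewer than [(r - b) * s] vertices, so one exceeds [2 * r - 4] and [core] applies. *)
Lemma no_full_outside f : good f -> (forall g, good g -> #|bad f| <= #|bad g|) ->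
  (forall d, d \notin bad f -> #|cls f d| < s) -> False.
Proof.
move=> fG minf lt_s; have [P [sP leP minP]] := exists_core_colors fG.
have cP : #|clss f P| = #|P| * s by apply: card_clss_full => c /(subsetP sP); apply: bad_full.
have inB x : x \in clss f P -> x \in clss f (bad f).
  by case/clssP=> c fx cP'; rewrite (in_clss _ fx) (subsetP sP).
have sumw : 2 * (#|clss f P| * (r - #|bad f|)) <= \sum_(y in clss f (~: bad f)) weight L f (clss f P) y.
  apply: sum_weight => [x _|x c /inB/clssP[d fx dB]].
    have := card_list_split listr x (bad f).
    by have := subset_leq_card (subsetIr (L x) (bad f)); lia.
  rewrite inE; exact: closed_nfree (@bad_closed f) fx dB.
have [|y /clssP[c fy cB] wy] := @exists_heavy (clss f (~: bad f)) f (clss f P) (2 * r - 4).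
  apply: leq_trans sumw; rewrite cP.
  have := card_clssC fG; have := bad_large fG; have := card_bad fG.
  move: leP ltD r_ge9; move: #|clss f _| #|bad f| #|P| #|D| => q b n0 N; clear; nia.
rewrite inE in cB.
apply: (@core f P y c) => //; first by move=> d /lt_s.
  by left; apply: lt_s.
by apply: leq_trans wy; lia.
Qed.

Lemma no_good f : ~~ good f.
Proof.
apply/negP=> f0G; case: (arg_minnP (fun g => #|bad g|) f0G) => {f0G}f fG minf.
case: (pickP [pred c | (c \notin bad f) && (#|cls f c| == s)]) => [c /andP[cB /eqP cs]|H]; last first.
  case: (no_full_outside fG minf) => d dB.
  by have /goodP[_ _ fs _] := fG; have := H d; rewrite /= dB /= ltn_neqAle fs => ->.
have /goodP[fP fD fs fp] := fG.
(* As [p < r], a full class [c] outside [bad f] leaves room for exactly [r - 2] bad colours and for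
   no further full class. *)
have sfull : c |: bad f \subset full f.
  by apply/subsetP=> d; rewrite !inE => /predU1P[->|dB]; rewrite ?cs // (bad_full fG) ?inE.
have b2 : #|bad f| = r - 2.
  by have := subset_leq_card sfull; have := bad_large fG; rewrite cardsU1 cB; lia.
have fullE : full f = c |: bad f.
  by apply/esym/eqP; rewrite eqEcard sfull cardsU1 cB b2; lia.
have lt_s d : d \notin bad f -> d != c -> #|cls f d| < s.
  move=> dB dc; rewrite ltn_neqAle fs andbT; apply/negP=> ds.
  have : d \in full f by rewrite inE.
  by rewrite fullE !inE (negPf dc) /=; apply/negP; rewrite inE in dB.
have [d [dB dc cd]] : exists d, [/\ d \notin bad f, d != c & mv L f c d].
  move: cB; rewrite inE negbK => /existsP[e /andP[/connect_uniq_path[q [cq cq_uniq qe]] lt_e]].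
  case: q cq cq_uniq qe => [|d q] /=; first by move=> _ _ ce; rewrite -ce cs ltnn in lt_e.
  case/andP=> cd dq /andP[]; rewrite inE negb_or eq_sym => /andP[dc _] _ qe.
  exists d; split=> //; rewrite inE negbK; apply/existsP; exists e.
  by rewrite lt_e andbT; apply/connectP; exists q.
have [w fw wd] := mvP L f c d cd.
have [P [sP leP minP]] := exists_core_colors fG.
(* If [d] can take [w] without becoming full, this move gives a minimal colouring without full
   classes outside its bad set. *)
have [ltd|led] := ltnP (#|cls f d| + 1) s.
  pose g := upd f w (Some d).
  have gcard e : #|cls g e| + (c == e) = #|cls f e| + (d == e).
    by have := card_cls_upd f w (Some d) e; rewrite fw !(inj_eq Some_inj).
  have glt e : e \notin bad f -> #|cls g e| < s.
    move=> eB; have := gcard e; have [<-|ce] := eqVneq c e.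
      by rewrite (negPf dc) addn0 addn1 cs => ->.
    rewrite addn0; have [<- ->//|de] := eqVneq d e.
    by rewrite addn0 => ->; rewrite lt_s // eq_sym.
  have gle e : e \in bad f -> #|cls g e| = #|cls f e|.
    move=> eB; have ce : c != e by apply: contraNneq cB => ->.
    have de : d != e by apply: contraNneq dB => ->.
    by have := gcard e; rewrite (negPf ce) (negPf de) !addn0.
  have sbad : bad g \subset bad f.
    apply/subsetP=> e; apply: contraLR => eB; rewrite inE negbK.
    exact/accessible_lt/glt.
  have gG : good g.
    apply/goodP; split.
    - exact: proper_col_upd.
    - by rewrite dom_upd /= fD; apply/setUidPr; rewrite sub1set -fD inE fw.
    - move=> e; have [eB|/glt/ltnW//] := boolP (e \in bad f).
      by rewrite gle.
    apply: leq_trans fp; rewrite fullE; apply: leq_trans (subset_leq_card (subsetUr _ _)).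
    apply/subset_leq_card/subsetP=> e; rewrite inE; apply: contraTT => /glt.
    by rewrite ltn_neqAle => /andP[].
  have badE : bad g = bad f by apply/eqP; rewrite eqEcard sbad minf.
  by apply: (no_full_outside gG) => [h|e]; rewrite badE; [exact: minf | exact: glt].
(* Classes [c] and [d] have at least [2 * s - 1] vertices together, and the [r - 2] bad classes
   leave fewer than [2 * s]. *)
have QE : clss f (~: bad f) = cls f c :|: cls f d.
  apply/esym/eqP; rewrite eqEcard; apply/andP; split.
    by apply/subsetP=> x; rewrite in_setU !in_cls => /orP[] /eqP fx; rewrite (in_clss _ fx) in_setC.
  have -> : #|cls f c :|: cls f d| = #|cls f c| + #|cls f d|.
    rewrite cardsU (_ : _ :&: _ = set0) ?cards0 ?subn0 //; apply/setP=> x; rewrite !inE.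
    by apply/negP=> /andP[/eqP-> /eqP[dc']]; rewrite dc' eqxx in dc.
  have := card_clssC fG; rewrite cs b2; move: led ltD r_ge9.
  move: #|clss f _| #|cls f d| #|D| => q n N; clear; nia.
(* The list of [x] has at least two colours outside [bad f]; all are blocked, so their classes are
   nonempty and only [c] and [d] qualify. *)
have cL x : x \in clss f P -> c \in L x.
  case/clssP=> e fx eP; apply: contraT => ncL.
  have : #|L x :&: ~: bad f| <= 1.
    rewrite -(cards1 d); apply/subset_leq_card/subsetP=> a; rewrite in_setI in_setC => /andP[aL aB].
    have := nfreeP aL (closed_nfree (@bad_closed f) fx (subsetP sP e eP) aB).
    case/card_gt0P=> z; rewrite !inE => /andP[_ /eqP fz].
    have : z \in clss f (~: bad f) by rewrite (in_clss _ fz) in_setC.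
    rewrite QE !inE fz => /orP[] /eqP[E]; last by rewrite E.
    by rewrite E (negPf ncL) in aL.
  have := card_list_split listr x (bad f).
  have := subset_leq_card (subsetIr (L x) (bad f)).
  by rewrite b2; move: r_ge9; clear; lia.
have cP : #|clss f P| = #|P| * s by apply: card_clss_full => e /(subsetP sP); apply: bad_full.
(* Since [w] can move to [d], it has no solo neighbours by [solo_stays]. The other [s - 1] vertices
   of class [c] thus share weight at least [2 * #|P| * s - r], and one of them exceeds
   [2 * r - 4]. *)
have ww : weight L f (clss f P) w <= r.
  rewrite /weight (_ : solo _ _ _ _ = set0) ?cards0 ?addn0.
    by apply: leq_trans (degr w); apply/subset_leq_card/subsetIl.
  apply/eqP/set0Pn => -[x xS].
  by have := solo_stays fG sP minP fw cB lt_s xS dB dc; rewrite wd.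
have [|y] := @exists_heavy (cls f c :\ w) f (clss f P) (2 * r - 4).
  have : 2 * (#|clss f P| * 1) <= \sum_(y in cls f c) weight L f (clss f P) y.
    rewrite -cls1; apply: sum_weight => [x /cL xc|x e /clssP[a fx aP]].
      by rewrite (setIidPr _) ?cards1 // sub1set.
    rewrite inE => /eqP->; exact: closed_nfree (@bad_closed f) fx (subsetP sP a aP) cB.
  rewrite (big_setD1 w) /=; last by rewrite in_cls fw.
  have := cardsD1 w (cls f c); rewrite in_cls fw eqxx cs cP.
  move: ww leP r_ge9; move: (weight _ _ _ _) (\sum_(_ in _) _) #|_ :\ w| #|P| => a b n m; clear; nia.
rewrite !inE => /andP[_ /eqP fy] wy.
apply: (@core f P y c) => //; first by right; exists w, d.
by apply: leq_trans wy; move: r_ge9; clear; lia.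
Qed.

End Step.

(** * Induction on the number of coloured vertices *)

Section Induction.
Variables (G : sgraph) (C : finType) (L : G -> {set C}) (r : nat).
Hypothesis classB : in_classB G.
Hypothesis listr : list_assignment r L.
Hypothesis r_ge9 : 9 <= r.
Hypothesis degr : forall x : G, #|nbrs x| <= r.

(* With [n %/ r + 1] in place of the ceiling this also covers [r %| n], where
   no class may have size [n %/ r + 1]. *)
Lemma equitable_partial (D : {set G}) : exists f : {ffun G -> option C},
  [/\ proper_col L f, dom f = D & balanced (#|D| %/ r).+1 (#|D| %% r) f].
Proof.
move En: #|D| => n; elim: n => [|n IHn] in D En *.
  exists [ffun=> None].
  have cls0 c : cls [ffun=> None] c = set0 :> {set G} by apply/setP=> x; rewrite !inE ffunE.
  split.
  - by apply/proper_colP=> x c; rewrite ffunE.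
  - by rewrite (cards0_eq En); apply/setP=> x; rewrite !inE ffunE.
  rewrite div0n mod0n; apply/andP; split; first by apply/forallP=> c; rewrite cls0 cards0.
  by rewrite leqn0 cards_eq0; apply/eqP/setP=> c; rewrite !inE cls0 cards0.
have nD : D != set0 by rewrite -card_gt0 En.
have [v vD degv] := exists_low_degree classB nD.
have En' : #|D :\ v| = n by move: En; rewrite (cardsD1 v) vD => -[].
have [f [fP fD fb]] := IHn _ En'.
have r_gt0 : 0 < r by lia.
pose s := (n %/ r).+1; pose p := n %% r.
have nE := divn_eq n r; have ltp : p < r by rewrite ltn_mod.
case: (pickP [pred g | [&& proper_col L g, dom g == D & balanced s p.+1 g]]) => [g|none]; last first.
  have /negP[] : ~~ good L (D :\ v) s p f; last by apply/and3P; rewrite fD.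
  apply: (no_good classB listr r_ge9 degr (v := v)) => //.
  - by rewrite !inE eqxx.
  - apply: leq_trans degv; apply/subset_leq_card/setIS; exact: subsetDl.
  - by rewrite En' mulnC ltn_ceil.
  - by move=> g gP gD; have := none g; rewrite /= gP gD setD1K // eqxx /= => ->.
case/and3P=> gP /eqP gD /andP[gs gp]; exists g; split=> //.
(* When [r] divides [n.+1], the target size rises to [s.+1] with residue 0: all classes have size at
   most [s], so none attains it. *)
have [pr|ltpr] := eqVneq p.+1 r.
  have [-> ->] : n.+1 %/ r = s /\ n.+1 %% r = 0.
    have -> : n.+1 = s * r by rewrite /s mulSn -/p; move: nE pr; rewrite /p; lia.
    by rewrite mulnK // modnMl.
  apply/andP; split.
    by apply/forallP=> c; apply: leqW; apply: (forallP gs).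
  rewrite leqn0 cards_eq0; apply/eqP/setP=> c; rewrite !inE.
  by apply/negbTE; rewrite neq_ltn ltnS (forallP gs c).
have [-> ->] : n.+1 %/ r = n %/ r /\ n.+1 %% r = p.+1.
  have -> : n.+1 = n %/ r * r + p.+1 by rewrite addnS {1}nE.
  have lt : p.+1 < r by rewrite ltn_neqAle ltpr.
  by split; [rewrite divnMDl // (divn_small lt) addn0 | rewrite modnMDl (modn_small lt)].
by apply/andP.
Qed.

End Induction.

Theorem theorem7 (G : sgraph) (r : nat) :
  in_classB G -> maxn 9 (max_degree G) <= r -> SE_choosable G r.
Proof.
move=> classB; rewrite geq_max => /andP[r_ge9 ledeg] C L listr.
have degr (x : G) : #|nbrs x| <= r.
  by apply: leq_trans ledeg; apply: (leq_bigmax x).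
have [f [/proper_colP fP fD /andP[/forallP fs fp]]] :=
  equitable_partial classB listr r_ge9 degr setT.
rewrite cardsT in fs fp.
have r_gt0 : 0 < r by lia.
have [F FE] : exists F : G -> C, forall x, f x = Some (F x).
  apply: (@fin_all_exists G (fun=> C) (fun x c => f x = Some c)) => x; have : x \in dom f by rewrite fD.
  by rewrite inE; case: (f x) => // c _; exists c.
exists (finfun F); split.
  split=> [v|u v uv]; first by have /freeP[] := fP v _ (FE v); rewrite ffunE.
  rewrite !ffunE; apply: contraTneq uv => Fuv; apply/negP=> uv.
  by have /freeP[_ /(_ v uv)] := fP u _ (FE u); rewrite FE Fuv.
have classP A : A \in color_classes (finfun F) ->
    exists2 x, x \in A & A = cls f (F x).
  case/imsetP=> x _ ->; exists x; first by rewrite !inE eqxx.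
  by apply/setP=> z; rewrite !inE !ffunE FE (inj_eq Some_inj) eq_sym.
have class_count m k : #|[set c | #|cls f c| == m]| <= k ->
    #|[set A in color_classes (finfun F) | #|A| == m]| <= k.
  apply: leq_trans; apply: leq_trans (leq_imset_card (cls f) _).
  apply/subset_leq_card/subsetP=> A; rewrite inE => /andP[/classP[x _ ->] Am].
  by apply: imset_f; rewrite inE.
rewrite /strongly_equitable /ceil_div /modstar; case: (boolP (r %| #|G|)) => [rG|_] /=; last first.
  rewrite addn1; split; last exact: class_count.
  by move=> A /classP[x _ ->]; apply: fs.
(* If [r] divides [#|G|], residue 0 excludes classes of size [#|G| %/ r + 1], so the ceiling
   [#|G| %/ r] bounds them all. *)
rewrite addn0; split.
  move=> A /classP[x _ ->]; move: fp; rewrite (eqP rG) leqn0 cards_eq0 => /eqP E.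
  have := fs (F x); rewrite leq_eqVlt => /orP[|//] e.
  have : F x \in full (#|G| %/ r).+1 f by rewrite inE.
  by rewrite E inE.
have [G0|G_gt0] := posnP #|G|.
  rewrite (_ : [set _ in _ | _] = set0) ?cards0 //; apply/setP=> A; rewrite !inE.
  by apply/negP=> /andP[/classP[x _ _] _]; have := fintype0 x.
have m_gt0 : 0 < #|G| %/ r by rewrite divn_gt0 // dvdn_leq.
apply: class_count; rewrite -(leq_pmul2r m_gt0).
rewrite -(@card_clss_full _ _ f _ (#|G| %/ r)) => [|c]; last by rewrite inE => /eqP.
by rewrite [r * _]mulnC divnK // max_card.
Qed.
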